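(* Let $p>5$ be a prime such that $-1$ is a quadratic residue modulo $p$ and $2$ and $3$ are both quadratic non-residues modulo $p$. Then the path system $\mathcal{P}_p$ on the Paley graph $G_p$ is irreducible and non-metrizable.
   Context: For a prime $p$ with $-1$ a quadratic residue (i.e. $p\equiv 1\pmod 4$), let $R$ and $N$ denote the sets of nonzero quadratic residues and quadratic non-residues in $\mathbb{F}_p$. The Paley graph $G_p$ has vertex set $\mathbb{F}_p$, with $a,b$ adjacent iff $a-b\in R$ (this relation is symmetric since $-1\in R$). A path system $\mathcal{P}$ in a graph $G=(V,E)$ is a collection of simple paths in $G$ such that for every pair of distinct vertices $u,v$ there is exactly one path $P_{u,v}\in\mathcal{P}$ connecting $u$ and $v$. $\mathcal{P}$ is metrizable if there exists $w:E\to(0,\infty)$ such that for all $u,v$, $w(P_{u,v})\le w(Q)$ for every $u$–$v$ path $Q$ in $G$ (where $w$ of a path is the sum of its edge weights). A partition $V=A\sqcup B$ with $A,B\neq\emptyset$ is a reduction of $\mathcal{P}$ if for all $u,v\in A$ all vertices of $P_{u,v}$ lie in $A$, and for all $u,v\in B$ all vertices of $P_{u,v}$ lie in $B$; $\mathcal{P}$ is irreducible if it has no reduction. The path system $\mathcal{P}_p$ on $G_p$ (assuming $2,3\in N$) is defined for $a\neq b\in\mathbb{F}_p$ by: if $b-a\in R$, then $P_{a,b}=(a,b)$; if $b-a=3$, then $P_{a,b}=(a,a+1,a+2,b)$ (and $P_{b,a}$ is the same path); if $b-a\in N$ and $b-a\neq\pm3$, then $P_{a,b}=(a,\tfrac{a+b}{2},b)$.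 *)

(* Defs.v *)
From HB Require Import structures.
From mathcomp Require Import all_boot all_order all_algebra.
From mathcomp Require Import reals.
Set Implicit Arguments. Unset Strict Implicit. Unset Printing Implicit Defensive.
Import Order.TTheory GRing.Theory Num.Theory.
Local Open Scope ring_scope.

Section Generic.
Variable T : finType.

Definition gpath (e : rel T) (u v : T) (s : seq T) : bool :=
  match s with
  | [::] => false
  | x :: t => [&& x == u, path e u t, last u t == v & uniq s]
  end.

(* P : T -> T -> seq T is a path system: P u v is a u-v simple path and
   the path between {u,v} is unique, i.e. P v u is P u v traversed backwards *)
Definition is_path_system (e : rel T) (P : T -> T -> seq T) : Prop :=
  forall u v, u != v -> gpath e u v (P u v) /\ P v u = rev (P u v).

Definition is_reduction (P : T -> T -> seq T) (A : {set T}) : Prop :=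
  [/\ A != set0, ~: A != set0,
      (forall u v, u \in A -> v \in A -> u != v -> all (mem A) (P u v)) &
      (forall u v, u \in ~: A -> v \in ~: A -> u != v -> all (mem (~: A)) (P u v))].

Definition irreducible_ps (P : T -> T -> seq T) : Prop :=
  forall A : {set T}, ~ is_reduction P A.

Fixpoint pweight (R : realType) (w : T -> T -> R) (s : seq T) : R :=
  match s with
  | x :: ((y :: _) as t) => w x y + pweight w t
  | _ => 0
  end.

Definition metrizable (R : realType) (e : rel T) (P : T -> T -> seq T) : Prop :=
  exists w : T -> T -> R,
    [/\ (forall x y, w x y = w y x),
        (forall x y, e x y -> 0 < w x y) &
        (forall u v, u != v -> forall Q, gpath e u v Q ->
            pweight w (P u v) <= pweight w Q)].
End Generic.

Section Paley.
Variable F : finFieldType.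

Definition qr (x : F) : bool := (x != 0) && [exists y : F, y ^+ 2 == x].
Definition qnr (x : F) : bool := (x != 0) && ~~ [exists y : F, y ^+ 2 == x].

Definition paley_adj : rel F := fun a b => qr (a - b).

Definition paley_ps (a b : F) : seq F :=
  if qr (b - a) then [:: a; b]
  else if b - a == 3 then [:: a; a + 1; a + 2; b]
  else if a - b == 3 then [:: a; a - 1; a - 2; b]   (* P_{a,b} = reverse of P_{b,a} *)
  else [:: a; (a + b) / 2; b].
End Paley.

(* Main.v *)
(** Averaging a weight [w] over translations gives an even function
    [f r = \sum_a w a (a + r)].  If the system is realised by [w], then
    [2 f(r) <= f(x) + f(y)] whenever [r], [x], [y] are residues, [x + y = 2 r]
    and [r <> 3/2, -3/2]; moreover [3 f(1) <= f(9) + f(-6)].  Let [M] be the set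
    of residues other than [3/2] and [-3/2] where [f] is maximal and [K] the
    remaining ones.  If the maximum is positive, then [1] lies in [K] by the last
    inequality.  By maximality, [2 r - y] is a non-residue for all [r] in [M] and
    [y] in [K], unless it is [3/2] or [-3/2].  Such a bias is impossible for two
    large sets, by the second moment of [\sum_(y in K) chi (2 r - y)]; and [M]
    and [K] both contain nearly a quarter of the field, because they contain the
    successors of a maximum point and the predecessors of [1] respectively.
    Hence [f(1) <= 0] as soon as [p >= 53]; the only smaller prime is [29].

    Non-metrizability is then immediate.  For irreducibility, the same estimate
    is applied to the cut semimetric of a reduction: it shows that the cut is
    invariant under translation by [1]. *)
Require Import Defs.
From HB Require Import structures.
From mathcomp Require Import all_boot all_order all_algebra.
From mathcomp Require Import fingroup cyclic reals.
From mathcomp Require Import ring lra zify.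
Import Order.TTheory GRing.Theory Num.Theory.
Local Open Scope ring_scope.

(** * Quadratic residues, the quadratic character and its sums *)

Section QuadraticCharacter.
Variable F : finFieldType.
Implicit Types x y c r : F.

Lemma qrP x : reflect (exists2 y, y != 0 & x = y ^+ 2) (qr x).
Proof.
apply: (iffP andP) => [[x0 /existsP[y /eqP yx]]|[y y0 ->]].
  by exists y => //; apply: contraNneq x0 => y0; rewrite -yx y0 expr0n.
by rewrite expf_neq0 //; split=> //; apply/existsP; exists y.
Qed.

Lemma qr_neq0 x : qr x -> x != 0. Proof. by case/andP. Qed.

Lemma qnr_neq0 x : qnr x -> x != 0. Proof. by case/andP. Qed.

Lemma qnrE x : qnr x = (x != 0) && ~~ qr x.
Proof. by rewrite /qnr /qr; case: (x != 0). Qed.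

Lemma qr_sqr y : y != 0 -> qr (y ^+ 2).
Proof. by move=> y0; apply/qrP; exists y. Qed.

Lemma qrM x y : qr x -> qr y -> qr (x * y).
Proof.
move=> /qrP[a a0 ->] /qrP[b b0 ->].
by rewrite -exprMn qr_sqr // mulf_neq0.
Qed.

Lemma qrV x : qr x -> qr x^-1.
Proof. by move=> /qrP[a a0 ->]; rewrite -exprVn qr_sqr // invr_eq0. Qed.

Lemma qnrMr x y : qr x -> qnr y -> qnr (x * y).
Proof.
move=> Rx; rewrite !qnrE => /andP[y0 Ny].
rewrite mulf_neq0 ?(qr_neq0 _ Rx) //=; apply: contra Ny => Rxy.
by rewrite -(mulKf (qr_neq0 _ Rx) y) qrM // qrV.
Qed.

(* The unit group is cyclic, and a non-residue is an odd power of a generator. *)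
Lemma qnrM x y : qnr x -> qnr y -> qr (x * y).
Proof.
have /cyclicP[g gE] := field_unit_group_cyclic [set: {unit F}]%G.
have odd_power z : qnr z -> exists2 i, odd i & z = val g ^+ i.
  rewrite qnrE => /andP[z0 Nz]; have uz : z \is a GRing.unit by rewrite unitfE.
  have : Sub z uz \in <[g]>%g by rewrite -gE inE.
  case/cycleP=> i /(congr1 val); rewrite FinRing.val_unitX /= => zE.
  exists i => //; apply: contraNT Nz => ei.
  by rewrite zE -(odd_double_half i) (negPf ei) add0n -muln2 exprM qr_sqr //
    expf_neq0 // -unitfE (valP g).
move=> /odd_power[i oi ->] /odd_power[j oj ->].
rewrite -exprD -(odd_double_half (i + j)) oddD oi oj add0n -muln2 exprM qr_sqr //.
by rewrite expf_neq0 // -unitfE (valP g).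
Qed.

Lemma qnrV x : qnr x -> qnr x^-1.
Proof.
move=> Nx; have x0 := qnr_neq0 _ Nx.
rewrite (_ : x^-1 = (x ^+ 2)^-1 * x); first by apply: qnrMr => //; rewrite qrV // qr_sqr.
by rewrite expr2 invfM mulfVK.
Qed.

(** The Legendre symbol, valued in [int] so that character sums turn directly into counts. *)
Definition chi x : int := if x == 0 then 0 else if qr x then 1 else -1.

Lemma chi0 : chi 0 = 0. Proof. by rewrite /chi eqxx. Qed.

Lemma chi_qr x : qr x -> chi x = 1.
Proof. by move=> Rx; rewrite /chi (negPf (qr_neq0 _ Rx)) Rx. Qed.

Lemma chi_qnr x : qnr x -> chi x = -1.
Proof. by rewrite qnrE /chi => /andP[/negPf -> /negPf ->]. Qed.

Variant chi_spec x : int -> bool -> bool -> Prop :=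
  | ChiZero of x = 0 : chi_spec x 0 false false
  | ChiQr of qr x : chi_spec x 1 true false
  | ChiQnr of qnr x : chi_spec x (-1) false true.

Lemma chiP x : chi_spec x (chi x) (qr x) (qnr x).
Proof.
rewrite qnrE /chi; case: eqVneq => [-> | x0] /=.
  by rewrite {1}/qr eqxx; constructor.
case: (boolP (qr x)) => h; constructor => //.
by rewrite qnrE x0.
Qed.

Lemma chiM x y : chi (x * y) = chi x * chi y.
Proof.
case: (chiP x) => [->|Rx|Nx]; first by rewrite !mul0r chi0.
  case: (chiP y) => [->|Ry|Ny]; first by rewrite !mulr0 chi0.
    by rewrite mulr1 chi_qr // qrM.
  by rewrite mul1r chi_qnr // qnrMr.
case: (chiP y) => [->|Ry|Ny]; first by rewrite !mulr0 chi0.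
  by rewrite mulr1 mulrC chi_qnr // qnrMr.
by rewrite chi_qr ?qnrM.
Qed.

Lemma chi_sqr x : x != 0 -> chi x * chi x = 1.
Proof. by move=> x0; rewrite -chiM -expr2 chi_qr ?qr_sqr. Qed.

Lemma qr1 : qr (1 : F). Proof. by rewrite -(expr1n _ 2) qr_sqr ?oner_neq0. Qed.

Lemma sum_affine (V : nmodType) (G : F -> V) a b :
  a != 0 -> \sum_x G (a * x + b) = \sum_x G x.
Proof.
move=> a0; rewrite [RHS](reindex (fun x => a * x + b)) //=.
exists (fun x => (x - b) / a) => x _; first by rewrite addrK mulrC mulKf.
by rewrite mulrC divfK // subrK.
Qed.

Hypothesis two_qnr : qnr (2 : F).
(** Doubling permutes the field and flips the sign of [chi], so the sum is its own opposite. *)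
Lemma sum_chi : \sum_x chi x = 0.
Proof.
have := sum_affine _ chi 2 0 (qnr_neq0 _ two_qnr).
under eq_bigr do rewrite addr0 chiM (chi_qnr _ two_qnr).
rewrite -mulr_sumr; set S := \sum_x chi x; move=> SE; lia.
Qed.

(* Substituting [x = c / u] turns [chi x * chi (x + c)] into [chi (1 + u)]. *)
Lemma sum_chi_shift c : c != 0 -> \sum_x chi x * chi (x + c) = -1.
Proof.
move=> c0; rewrite (bigD1 0) //= chi0 mul0r add0r.
rewrite (reindex_onto (fun u => c / u) (fun u => c / u)) /=; last first.
  by move=> x _; rewrite invfM invrK mulrA divff // mul1r.
have E u : ((c / u != 0) && (c / (c / u) == u)) = (u != 0).
  have [->|u0] := eqVneq u 0; first by rewrite invr0 mulr0 eqxx.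
  by rewrite mulf_neq0 ?invr_eq0 //= invfM invrK mulrA divff // mul1r eqxx.
under eq_bigl do rewrite E.
transitivity (\sum_(u | u != 0) chi (1 * u + 1)).
  apply: eq_bigr => u u0.
  rewrite (_ : c / u + c = c / u * (1 * u + 1)); last by field.
  by rewrite [chi (_ * (1 * u + 1))]chiM mulrA chi_sqr ?mul1r // mulf_neq0 ?invr_eq0.
have := sum_affine _ chi 1 1 (oner_neq0 _).
rewrite sum_chi (bigD1 0) //= mulr0 add0r (chi_qr _ qr1).
set S := \sum_(i | _) _; lia.
Qed.

Lemma sum_chi_sqr : \sum_x chi x * chi x = #|F|%:Z - 1.
Proof.
rewrite (bigD1 0) //= chi0 mul0r add0r.
under eq_bigr => x x0 do rewrite chi_sqr //.
have := cardC1 (0 : F); have : (0 < #|F|)%N by apply/card_gt0P; exists 0.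
rewrite sumr_const => F0 ->; rewrite natz; case: #|F| F0 => // n _; lia.
Qed.

Lemma sum_chi_corr a b :
  \sum_x chi (2 * x - a) * chi (2 * x - b) = if a == b then #|F|%:Z - 1 else -1.
Proof.
pose G x := chi x * chi (x + (a - b)).
transitivity (\sum_x G (2 * x - a)).
  by apply: eq_bigr => x _; rewrite /G addrA subrK.
rewrite sum_affine ?qnr_neq0 // /G; case: eqVneq => [->|ab].
  by under eq_bigr do rewrite subrr addr0; exact: sum_chi_sqr.
by rewrite sum_chi_shift // subr_eq0.
Qed.

(** Twice the indicator of the residues is [chi x * chi x + chi x]. *)
Lemma card_qr : (2 * #|[set x : F | qr x]|).+1 = #|F|.
Proof.
have : 2 * #|[set x : F | qr x]|%:Z = #|F|%:Z - 1; last by lia.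
transitivity (\sum_(x : F) (chi x * chi x + chi x)); last first.
  by rewrite big_split /= sum_chi_sqr sum_chi addr0.
rewrite -sum1_card big_mkcond /= -[X in 2 * X]natz natr_sum mulr_sumr; apply: eq_bigr => x _.
by rewrite inE; case: (chiP x).
Qed.

(** Expand the square and sum over [x] first: by [sum_chi_corr] each [y] in [K] contributes q - 1
    from the diagonal and -1 for each of the other |K| - 1 elements. *)
Lemma second_moment (K : {set F}) :
  \sum_x (\sum_(y in K) chi (2 * x - y)) ^+ 2 = #|K|%:Z * (#|F|%:Z - #|K|%:Z).
Proof.
under eq_bigr do rewrite expr2 big_distrlr /=.
rewrite exchange_big /=; under eq_bigr do rewrite exchange_big /=.
transitivity (\sum_(y in K) (#|F|%:Z - #|K|%:Z)); last first.
  by rewrite sumr_const mulrC -[#|K|%:Z in RHS]natz mulr_natr natz.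
apply: eq_bigr => y Ky; under eq_bigr do rewrite sum_chi_corr.
rewrite (bigD1 y) //= eqxx.
under eq_bigr => z /andP[_ zy] do rewrite eq_sym (negPf zy).
rewrite (eq_bigl (mem (K :\ y))); last by move=> z; rewrite !inE andbC.
by rewrite sumr_const (cardsD1 y K) Ky /= mulNrn natz; lia.
Qed.

Hypothesis opp1_qr : qr (-1 : F).

Lemma qrN x : qr (- x) = qr x.
Proof.
by apply/idP/idP => Rx; [rewrite -[x]opprK|]; rewrite -mulN1r qrM.
Qed.

Lemma chiN x : chi (- x) = chi x.
Proof. by rewrite -mulN1r chiM chi_qr // mul1r. Qed.

(** Four times the indicator of the set is (1 + chi x)(1 + chi (2r - x)); of the expanded sum only q
    and the correlation -1 survive. *)
Lemma card_qr_midpoint r : qr r ->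
  (4 * #|[set x | qr x && qr (2 * r - x)]|).+1 = #|F|.
Proof.
move=> Rr; have Nr : qnr (2 * r) by rewrite mulrC qnrMr.
set C := [set x | _].
have CE : #|C|%:Z = \sum_x (qr x && qr (2 * r - x))%:Z.
  rewrite -sum1_card big_mkcond /= -!natz natr_sum; apply: eq_bigr => x _.
  by rewrite inE; case: (_ && _).
have key x : 4 * (qr x && qr (2 * r - x))%:Z =
    1 + chi x + chi (- 1 * x + 2 * r) + chi x * chi (x + - (2 * r)).
  (* Since [2 * r] is a non-residue, both sides vanish at [x = 0] and [x = 2 * r]. *)
  rewrite mulN1r [- x + _]addrC -(chiN (x - _)) opprB.
  case: (chiP x) => [->|Rx|Nx]; first by rewrite subr0 chi_qnr.
    case: (chiP (2 * r - x)) => [/eqP|R2|N2] //.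
    by rewrite subr_eq0 => /eqP rx; move: Rx Nr; rewrite qnrE rx => -> /=; rewrite andbF.
  by case: (chiP (2 * r - x)).
have : 4 * #|C|%:Z = #|F|%:Z - 1; last by lia.
rewrite CE mulr_sumr (eq_bigr _ (fun x _ => key x)) !big_split /=.
rewrite sum_chi_shift ?oppr_eq0 ?qnr_neq0 // sum_affine ?oppr_eq0 ?oner_neq0 //.
by rewrite sum_chi !addr0 sumr_const natz.
Qed.

End QuadraticCharacter.

(** Here m, n, v stand for |M|, |K|, |V| and q = 4k + 1. Both m and n are close to k, so the left
    side of the last inequality is cubic in k and the right side quadratic. The threshold 53 is
    sharp: q = 49, n = 9, m = 13 satisfies the other constraints. *)
Lemma no_balanced_split (k m n v : nat) :
  (53 <= (4 * k).+1 -> m + n = v -> 2 * v + 5 = (4 * k).+1 ->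
  (4 * k).+1 <= 4 * (m + 4) + 1 -> (4 * k).+1 <= 4 * (n + 3) + 1 ->
  (4 <= n -> m * (n - 4) ^ 2 <= n * ((4 * k).+1 - n)) -> False)%N.
Proof.
move=> k13 mn v2 m_ge n_ge main.
have [t tE] : exists t, (k = 13 + t)%N by exists (k - 13)%N; lia.
(* The size constraints confine n to the window from k - 3 to k + 2; [j] is its position there. *)
have [j jE] : exists j, (n = 10 + t + j)%N by exists (n - (10 + t))%N; lia.
have {}main := main ltac:(lia).
have mE : (m = 14 + t - j)%N by lia.
have j5 : (j <= 5)%N by lia.
subst k n m; rewrite -mulnn in main; clear -main j5.
case: j j5 main => [|[|[|[|[|[|//]]]]]] _; nia.
Qed.

(** * The maximum principle for an abstract potential *)

Section MaximumPrinciple.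
Variables (F : finFieldType) (R : realDomainType) (f : F -> R).
Implicit Types x y r : F.

Let h : F := 3 / 2.

Hypothesis opp1_qr : qr (-1 : F).
Hypothesis two_qnr : qnr (2 : F).
Hypothesis three_qnr : qnr (3 : F).
Hypothesis five_neq0 : (5 : F) != 0.
Hypothesis seven_neq0 : (7 : F) != 0.

Hypothesis f_midpoint : forall r x y, qr r -> r != h -> r != - h ->
  qr x -> qr y -> x + y = 2 * r -> 2 * f r <= f x + f y.
Hypothesis f_three : 3 * f 1 <= f 9 + f (-6).

Let two_neq0 : (2 : F) != 0 := qnr_neq0 _ _ two_qnr.
Let three_neq0 : (3 : F) != 0 := qnr_neq0 _ _ three_qnr.

(** The residues at which [f_midpoint] is available: the pairs at difference 2h = 3 or -3 are not
    joined through their midpoint. *)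
Let V : {set F} := [set x | [&& qr x, x != h & x != - h]].

Let h_qr : qr h.
Proof. by rewrite qnrM // qnrV. Qed.

Let neq_hP x : 2 * x - 3 != 0 -> 2 * x + 3 != 0 -> (x != h) && (x != - h).
Proof.
move=> a b; apply/andP; split.
  by apply: contra a => /eqP ->; apply/eqP; rewrite /h; field.
by apply: contra b => /eqP ->; apply/eqP; rewrite /h; field.
Qed.

(** The arguments 1, 9 and -6 of [f_three] must lie in [V] to be compared with the maximum. Since 2
    + 3 = 5 and 18 + 3 = 3 * 7, this is where 5 and 7 have to be nonzero. *)
Let one_V : 1 \in V.
Proof.
rewrite inE qr1 /=; apply: neq_hP.
  by rewrite (_ : 2 * 1 - 3 = - 1) ?oppr_eq0 ?oner_neq0 //; ring.
by rewrite (_ : 2 * 1 + 3 = 5) //; ring.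
Qed.

Let nine_V : 9 \in V.
Proof.
rewrite inE (_ : 9 = 3 ^+ 2) ?qr_sqr //=; last by ring.
apply: neq_hP; [rewrite (_ : _ - _ = 3 * 5)|rewrite (_ : _ + _ = 3 * 7)];
  by [rewrite mulf_neq0 | ring].
Qed.

Let oppsix_V : -6 \in V.
Proof.
have E : -6 = - (2 * 3) :> F by ring.
rewrite inE {1}E qrN // (qnrM _ _ _ two_qnr three_qnr) /=.
apply: neq_hP; [rewrite (_ : _ - _ = - (3 * 5))|rewrite (_ : _ + _ = - (3 * 3))];
  by [rewrite ?oppr_eq0 mulf_neq0 | ring].
Qed.

Let card_V : (2 * #|V| + 5)%N = #|F|.
Proof.
rewrite -(card_qr _ two_qnr); set Q := [set x : F | qr x].
have hQ : h \in Q by rewrite inE.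
have hQ' : - h \in Q :\ h.
  rewrite !inE qrN // h_qr andbT -subr_eq0 (_ : - h - h = - 3) ?oppr_eq0 //.
  by rewrite /h; field.
have VE : V = Q :\ h :\ - h.
  by apply/setP => x; rewrite !inE; case: (qr x); case: (x == h); case: (x == - h).
have := cardsD1 h Q; have := cardsD1 (- h) (Q :\ h).
by rewrite hQ hQ' -VE => -> ->; rewrite addnA mulnDr addnC.
Qed.

(** The 1 is only the default that witnesses that [V] is nonempty. *)
Let r0 := [arg max_(x > 1 in V) f x]%O.
Let M : {set F} := [set x in V | f x == f r0].

Let f_le_max x : x \in V -> f x <= f r0.
Proof. by rewrite /r0; case: arg_maxP => // i _ le /le. Qed.

Let r0_M : r0 \in M.
Proof. by rewrite !inE eqxx andbT; rewrite /r0; case: arg_maxP; rewrite // => i; rewrite inE. Qed.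

(** A maximal value at the midpoint forces both ends to be maximal, since neither exceeds the
    maximum. *)
Let M_midpoint r x y : r \in M -> x \in V -> y \in V -> x + y = 2 * r -> x \in M.
Proof.
move=> /setIdP[]; rewrite inE => /and3P[Rr rh rh'] /eqP fr Vx Vy xy.
rewrite inE Vx; have := f_le_max _ Vx; have := f_le_max _ Vy.
move: Vx Vy; rewrite !inE => /andP[Rx _] /andP[Ry _].
have := f_midpoint _ _ _ Rr rh rh' Rx Ry xy; rewrite fr; lra.
Qed.

Let K := V :\: M.

Let card_M : (#|F| <= 4 * (#|M| + 4) + 1)%N.
Proof.
have /setIdP[] := r0_M; rewrite inE => /andP[Rr _] _.
rewrite -(card_qr_midpoint _ two_qnr opp1_qr _ Rr) addn1 ltnS leq_mul2l /=.
set C := [set x | _].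
(* The four exceptions are those where [x] or its partner [2 * r0 - x] equals [h] or [- h]. *)
have sub : C \subset M :|: [set:: [:: h; - h; 2 * r0 - h; 2 * r0 + h]].
  apply/subsetP => x; rewrite !inE => /andP[Rx Ry].
  apply: contraTT isT; rewrite !negb_or => /andP[nM /and4P[n1 n2 n3 n4]].
  have Vx : x \in V by rewrite inE Rx n1.
  have Vy : 2 * r0 - x \in V.
    rewrite inE Ry /=; apply/andP; split.
      by apply: contra n3 => /eqP <-; apply/eqP; ring.
    by apply: contra n4 => /eqP E; apply/eqP; rewrite -[h]opprK -E; ring.
  case/negP: nM; have := M_midpoint _ _ _ r0_M Vx Vy; rewrite !inE Rx n1 n2 /=.
  by apply; ring.
apply: leq_trans (subset_leq_card sub) _; apply: leq_trans (leq_card_setU _ _) _.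
by rewrite leq_add2l cardsE card_size.
Qed.

(** A residue [2 * r - y] in [V] would put [y] into [M] by [M_midpoint]; it is not zero because
    [2 * r] is a non-residue and [y] a residue. *)
Let K_qnr r y : r \in M -> y \in K -> y != 2 * r - h -> y != 2 * r + h ->
  qnr (2 * r - y).
Proof.
move=> Mr /setDP[Vy nMy] n1 n2.
have Rr : qr r by have /setIdP[] := Mr; rewrite inE => /andP[].
have Ry : qr y by move: Vy; rewrite inE => /andP[].
rewrite qnrE; apply/andP; split.
  apply: contraTN Ry; rewrite subr_eq0 => /eqP <-.
  by have := qnrMr _ _ _ Rr two_qnr; rewrite mulrC qnrE => /andP[].
apply: contra nMy => Rz; apply: (M_midpoint _ _ (2 * r - y) Mr) => //; last by ring.
rewrite inE Rz /=; apply/andP; split.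
  by apply: contra n1 => /eqP <-; apply/eqP; ring.
by apply: contra n2 => /eqP E; apply/eqP; rewrite -[h]opprK -E; ring.
Qed.

Let sum_K_le r : r \in M -> \sum_(y in K) chi _ (2 * r - y) <= 4 - #|K|%:Z.
Proof.
(* [G] majorises the terms: -1 in general, and at least 1 at the two possible exceptions, each of
   which costs 2. *)
move=> Mr; pose G y : int := -1 + 2 * ((y == 2 * r - h)%:Z + (y == 2 * r + h)%:Z).
have single c : \sum_(y in K) (y == c)%:Z <= 1.
  have [Kc|nKc] := boolP (c \in K).
    rewrite (bigD1 c) //= eqxx big1 ?addr0 // => y /andP[_ /negPf -> //].
  by rewrite big1 // => y Ky; case: eqVneq => // E; rewrite -E Ky in nKc.
apply: (@le_trans _ _ (\sum_(y in K) G y)).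
  apply: ler_sum => y Ky; rewrite /G.
  case: eqVneq => [_|n1]; first by case: chiP; case: eqVneq.
  case: eqVneq => [_|n2]; first by case: chiP.
  by rewrite (chi_qnr _ _ (K_qnr _ _ Mr Ky n1 n2)).
rewrite big_split /= sumr_const -mulr_sumr big_split /= mulNrn (natz #|K|).
have aux (a b n : int) : a <= 1 -> b <= 1 -> - n + 2 * (a + b) <= 4 - n by clear; lia.
exact: aux (single _) (single _).
Qed.

(** For [x] in [M] the inner sum is at most 4 - |K|, hence its square is at least (|K| - 4)^2 once 4
    <= |K|; the second moment bounds the total. *)
Let M_K_bound : (4 <= #|K| -> #|M| * (#|K| - 4) ^ 2 <= #|K| * (#|F| - #|K|))%N.
Proof.
move=> K4; have KF : (#|K| <= #|F|)%N := max_card _.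
suff : #|M|%:Z * (#|K|%:Z - 4) ^+ 2 <= #|K|%:Z * (#|F|%:Z - #|K|%:Z).
  by rewrite -lez_nat !PoszM -!subzn // -[_ ^ 2]/(_ * _)%N PoszM subzn.
rewrite -second_moment //.
apply: (@le_trans _ _ (\sum_(x in M) (\sum_(y in K) chi _ (2 * x - y)) ^+ 2)).
  rewrite -[#|M|%:Z]natz mulr_natl -sumr_const; apply: ler_sum => x Mx.
  have := sum_K_le _ Mx; move: (\sum_(y in K) _) K4 => s; move: #|K| => n; clear; nia.
rewrite [leRHS](bigID (mem M)) /= lerDl sumr_ge0 // => x _; exact: sqr_ge0.
Qed.

(** If [x] and [2 - x] are residues and d = 1/x, then d and 2d - 1 = (2 - x)d are residues, and d is
    the midpoint of 1 and 2d - 1. Thus d in [M] would put 1 in [M]. Inversion is injective, so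
    nearly a quarter of the field lands in [K]. *)
Let card_K : 1 \notin M -> (#|F| <= 4 * (#|K| + 3) + 1)%N.
Proof.
move=> nM1; rewrite -(card_qr_midpoint _ two_qnr opp1_qr _ (qr1 _)) addn1 ltnS leq_mul2l /=.
set C := [set x | _].
pose E := [set:: [:: - h; (1 + h) / 2; (1 - h) / 2]].
have inv x : x \in C -> x^-1 \in K :|: E.
  rewrite inE mulr1 => /andP[Rx Ry]; have x0 := qr_neq0 _ _ Rx.
  set d := x^-1; have Rd : qr d by rewrite qrV.
  have Re : qr (2 * d - 1).
    by rewrite (_ : _ - _ = (2 - x) * d) ?qrM // mulrBl mulfV.
  rewrite in_setU; case: (boolP (d \in K)) => //= nK; rewrite !inE.
  apply: contraTT isT; rewrite !negb_or => /and3P[n1 n2 n3].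
  (* Only three exceptions occur: d = h would make 2d - 1 = 2 a residue. *)
  have dh : d != h.
    apply: contraTneq Re => ->; rewrite (_ : _ - _ = 2); last by rewrite /h; field.
    by move: two_qnr; rewrite qnrE => /andP[].
  have Vd : d \in V by rewrite inE Rd dh.
  have Ve : 2 * d - 1 \in V.
    rewrite inE Re /=; apply/andP; split.
      by apply: contra n2 => /eqP <-; apply/eqP; field.
    by apply: contra n3 => /eqP E'; apply/eqP; rewrite -[h]opprK -E'; field.
  have Md : d \in M by move: nK; rewrite in_setD Vd andbT negbK.
  by case/negP: nM1; apply: (M_midpoint _ _ _ Md one_V Ve); ring.
rewrite -(card_imset _ (@invr_inj F)).
have sub : [set x^-1 | x in C] \subset K :|: E.
  by apply/subsetP => _ /imsetP[x Cx ->]; exact: inv.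
apply: leq_trans (subset_leq_card sub) _; apply: leq_trans (leq_card_setU _ _) _.
by rewrite leq_add2l cardsE card_size.
Qed.

Lemma potential_one_le0 : (53 <= #|F|)%N -> f 1 <= 0.
Proof.
move=> F53; case: (lerP (f r0) 0) => [|fr0]; first exact/le_trans/f_le_max/one_V.
(* If [f 1] were the maximum, [f_three] would bound three times a positive number by twice that
   number. *)
have nM1 : 1 \notin M.
  rewrite inE one_V /=; apply/eqP => f1.
  have := f_three; have := f_le_max _ nine_V; have := f_le_max _ oppsix_V; rewrite f1; lra.
have mn : (#|M| + #|K| = #|V|)%N.
  by rewrite -(cardsID M V) (_ : V :&: M = M) //; apply/setIidPr/subsetP => x /setIdP[].
have qE := card_qr_midpoint _ two_qnr opp1_qr _ (qr1 _).
have := card_K nM1; have := M_K_bound; have := card_M; have := card_V; move: F53.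
rewrite -qE => F53 v2 m_ge main n_ge.
by case: (no_balanced_split _ _ _ _ F53 mn v2 m_ge n_ge main).
Qed.

End MaximumPrinciple.

(** * Sums of a weight over translates *)

Section Translations.
Variables (F : finFieldType) (R : realDomainType) (w : F -> F -> R).

(** The average is left undivided, so that it also makes sense for the [int]-valued cut
    semimetric. *)
Definition translation_sum (r : F) : R := \sum_a w a (a + r).

Lemma translation_sum_shift c r : \sum_a w (a + c) (a + c + r) = translation_sum r.
Proof.
have := sum_affine _ _ (fun a => w a (a + r)) 1 c (oner_neq0 _).
by under eq_bigr do rewrite mul1r.
Qed.

Lemma translation_sumN r : (forall x y, w x y = w y x) ->
  translation_sum (- r) = translation_sum r.
Proof.
move=> wC; rewrite -(translation_sum_shift r); apply: eq_bigr => a _.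
by rewrite addrK wC.
Qed.

End Translations.

(** Up to sign the residues other than 3/2 and -3/2 are 1, 4, 5, 6, 7, 9. The five midpoint
    inequalities below carry a maximum from any of them to 1, and then the last hypothesis gives the
    claim. *)
Lemma potential_F29 (R : realDomainType) (f : 'F_29 -> R) :
  (forall x, f (- x) = f x) ->
  (forall r x y, qr r -> r != 3 / 2 -> r != - (3 / 2) ->
     qr x -> qr y -> x + y = 2 * r -> 2 * f r <= f x + f y) ->
  3 * f 1 <= f 9 + f (-6) -> f 1 <= 0.
Proof.
move=> fN f_mid f3.
have sq (y : 'F_29) x : y != 0 -> y ^+ 2 = x -> qr x by move=> y0 <-; exact: qr_sqr.
have q1 : qr (1 : 'F_29) := qr1 _.
have q4 : qr (4 : 'F_29) by apply: (sq 2) => //; exact/eqP.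
have q5 : qr (5 : 'F_29) by apply: (sq 11) => //; exact/eqP.
have q6 : qr (6 : 'F_29) by apply: (sq 8) => //; exact/eqP.
have q7 : qr (7 : 'F_29) by apply: (sq 6) => //; exact/eqP.
have q9 : qr (9 : 'F_29) by apply: (sq 3) => //; exact/eqP.
have qN4 : qr (-4 : 'F_29) by apply: (sq 5) => //; exact/eqP.
have qN7 : qr (-7 : 'F_29) by apply: (sq 14) => //; exact/eqP.
have f41 : 2 * f 4 <= f 1 + f 7 by apply: f_mid => //; exact/eqP.
have f51 : 2 * f 5 <= f 1 + f 9 by apply: f_mid => //; exact/eqP.
have f65 : 2 * f 6 <= f 5 + f 7 by apply: f_mid => //; exact/eqP.
have f75 : 2 * f 7 <= f 5 + f 9 by apply: f_mid => //; exact/eqP.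
have f94 : 2 * f 9 <= f (-7) + f (-4) by apply: f_mid => //; exact/eqP.
rewrite (fN 7) (fN 4) in f94; rewrite (fN 6) in f3.
move: (f 1) (f 4) (f 5) (f 6) (f 7) (f 9) f41 f51 f65 f75 f94 f3; clear=> *; lra.
Qed.

(** * The potential over prime fields, and its use for weights *)

Section PrimeField.
Variable p : nat.
Hypotheses (p_prime : prime p) (p_gt5 : (5 < p)%N).
Hypotheses (opp1_qr : qr (-1 : 'F_p)) (two_qnr : qnr (2 : 'F_p)) (three_qnr : qnr (3 : 'F_p)).

Lemma potential_Fp (R : realDomainType) (f : 'F_p -> R) :
  (forall x, f (- x) = f x) ->
  (forall r x y, qr r -> r != 3 / 2 -> r != - (3 / 2) ->
     qr x -> qr y -> x + y = 2 * r -> 2 * f r <= f x + f y) ->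
  3 * f 1 <= f 9 + f (-6) -> f 1 <= 0.
Proof.
have := card_qr_midpoint _ two_qnr opp1_qr _ (qr1 _).
rewrite card_Fp //; move: #|_| => k pE fN f_mid f3.
have [p53|p53] := leqP 53 p.
  have natF n : (0 < n < 53)%N -> (n%:R : 'F_p) != 0.
    move=> /andP[n0 n53]; rewrite -(dvdn_pcharf (pchar_Fp p_prime)).
    by apply/negP => /(dvdn_leq n0) /(leq_trans p53); rewrite leqNgt n53.
  by apply: (potential_one_le0 _ _ f) => //; rewrite ?natF // card_Fp.
have no_sq2 (y : 'F_p) : y ^+ 2 <> 2.
  by move=> y2; move: two_qnr => /andP[_ /existsP[]]; exists y; apply/eqP.
have no_sq3 (y : 'F_p) : y ^+ 2 <> 3.
  by move=> y3; move: three_qnr => /andP[_ /existsP[]]; exists y; apply/eqP.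
have k13 : (k < 13)%N by rewrite -pE ltnS in p53; rewrite -(ltn_pmul2l (isT : 0 < 4)%N).
(* With p = 4k + 1 concrete, computation leaves 13, 17, 29, 37 and 41. All but 29 contradict the
   hypotheses: 3 is the square of 4 mod 13 and of 15 mod 37, and 2 that of 6 mod 17 and of 17 mod
   41. *)
move: p_prime p_gt5 f fN f_mid f3 no_sq2 no_sq3 k13; rewrite -pE; clear.
do 13?[case: k => [|k] //].
- by move=> ? ? f _ _ _ _ /(_ 4) []; apply/eqP.
- by move=> ? ? f _ _ _ /(_ 6) []; apply/eqP.
- by move=> ? ? f fN fm f3 ? ? ?; apply: (potential_F29 _ f fN fm f3).
- by move=> ? ? f _ _ _ _ /(_ 15) []; apply/eqP.
- by move=> ? ? f _ _ _ /(_ 17) []; apply/eqP.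
Qed.

(** Summing the pointwise inequalities over [a] gives those of the potential. The common form serves
    both a realising weight and the cut of a reduction. *)
Lemma weight_potential (R : realDomainType) (w : 'F_p -> 'F_p -> R) :
  (forall x y, w x y = w y x) ->
  (forall a r x, qr r -> r != 3 / 2 -> r != - (3 / 2) -> qr x -> qr (2 * r - x) ->
     w a (a + r) + w (a + r) (a + 2 * r) <= w a (a + x) + w (a + x) (a + 2 * r)) ->
  (forall a, w a (a + 1) + w (a + 1) (a + 2) + w (a + 2) (a + 3) <=
     w a (a + 9) + w (a + 9) (a + 3)) ->
  \sum_a w a (a + 1) <= 0.
Proof.
move=> wC w_mid w3.
have shift c d r : c + r = d -> \sum_a w (a + c) (a + d) = translation_sum _ _ w r.
  by move=> <-; rewrite -(translation_sum_shift _ _ w c); under eq_bigr do rewrite addrA.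
apply: (potential_Fp _ (translation_sum _ _ w)) => [x|r x y Rr rh rh' Rx Ry xy|].
- exact: translation_sumN.
- have yE : 2 * r - x = y by rewrite -xy addrC addKr.
  have : \sum_a (w a (a + r) + w (a + r) (a + 2 * r)) <=
         \sum_a (w a (a + x) + w (a + x) (a + 2 * r)).
    by apply: ler_sum => a _; apply: w_mid; rewrite ?yE.
  rewrite !big_split /= (shift r (2 * r) r) ?(shift x (2 * r) y) //; last by ring.
  by rewrite mulr_natl mulr2n.
have : \sum_a (w a (a + 1) + w (a + 1) (a + 2) + w (a + 2) (a + 3)) <=
       \sum_a (w a (a + 9) + w (a + 9) (a + 3)).
  by apply: ler_sum => a _; exact: w3.
rewrite !big_split /= (shift 1 2 1) ?(shift 2 3 1) ?(shift 9 3 (-6)); try by ring.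
by rewrite -/(translation_sum _ _ w 1) -/(translation_sum _ _ w 9); lra.
Qed.

End PrimeField.

(** * Paths of the Paley graph and the path system *)

Section PaleySystem.
Variable F : finFieldType.
Hypotheses (opp1_qr : qr (-1 : F)) (two_qnr : qnr (2 : F)) (three_qnr : qnr (3 : F)).

Let two_neq0 : (2 : F) != 0 := qnr_neq0 _ _ two_qnr.
Let three_neq0 : (3 : F) != 0 := qnr_neq0 _ _ three_qnr.

Let subr_neq0 (x y : F) : y - x != 0 -> (x == y) = false.
Proof. by rewrite subr_eq0 eq_sym => /negPf. Qed.

Lemma paley_adjE (a b : F) : @paley_adj F a b = qr (b - a).
Proof. by rewrite /paley_adj -opprB qrN. Qed.

Lemma gpath_paley2 (a b c : F) : qr (b - a) -> qr (c - b) -> c != a ->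
  gpath (@paley_adj F) a c [:: a; b; c].
Proof.
move=> Rab Rbc ca; rewrite /gpath /= !paley_adjE Rab Rbc !eqxx !inE.
by rewrite (eq_sym a c) (negPf ca) (subr_neq0 _ _ (qr_neq0 _ _ Rab))
   (subr_neq0 _ _ (qr_neq0 _ _ Rbc)).
Qed.

(** The steps e = 1 and e = -1 cover the special path and its reverse. *)
Lemma gpath_paley3 (a e : F) : qr e ->
  gpath (@paley_adj F) a (a + 3 * e) [:: a; a + e; a + 2 * e; a + 3 * e].
Proof.
move=> Re; have e0 := qr_neq0 _ _ Re.
have d01 : a + e - a = e by ring.
have d02 : a + 2 * e - a = 2 * e by ring.
have d03 : a + 3 * e - a = 3 * e by ring.
have d12 : a + 2 * e - (a + e) = e by ring.
have d13 : a + 3 * e - (a + e) = 2 * e by ring.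
have d23 : a + 3 * e - (a + 2 * e) = e by ring.
have distinct x y : y - x \in [:: e; 2 * e; 3 * e] -> (x == y) = false.
  rewrite !inE => yx; apply: subr_neq0.
  by case/or3P: yx => /eqP ->; rewrite ?mulf_neq0.
rewrite /gpath /= !paley_adjE d01 d12 d23 Re !eqxx !inE.
rewrite (distinct a (a + e)) ?d01 ?inE ?eqxx //.
rewrite (distinct a (a + 2 * e)) ?d02 ?inE ?eqxx ?orbT //.
rewrite (distinct a (a + 3 * e)) ?d03 ?inE ?eqxx ?orbT //.
rewrite (distinct (a + e) (a + 2 * e)) ?d12 ?inE ?eqxx //.
rewrite (distinct (a + e) (a + 3 * e)) ?d13 ?inE ?eqxx ?orbT //.
by rewrite (distinct (a + 2 * e) (a + 3 * e)) ?d23 ?inE ?eqxx.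
Qed.

Lemma paley_ps_midpoint (a r : F) : qr r -> r != 3 / 2 -> r != - (3 / 2) ->
  paley_ps a (a + 2 * r) = [:: a; a + r; a + 2 * r].
Proof.
move=> Rr rh rh'; have := qnrMr _ _ _ Rr two_qnr; rewrite mulrC qnrE => /andP[_ /negPf n].
rewrite /paley_ps (_ : a + 2 * r - a = 2 * r) 1?addrC ?addKr // n.
case: eqVneq => [E|_]; first by case/eqP: rh; rewrite -E mulrC mulKf.
case: eqVneq => [E|_]; first by case/eqP: rh'; rewrite -E; field.
by congr [:: _; _; _]; field.
Qed.

Lemma paley_ps_three (a : F) : paley_ps a (a + 3) = [:: a; a + 1; a + 2; a + 3].
Proof.
rewrite /paley_ps (_ : a + 3 - a = 3) 1?addrC ?addKr // eqxx.
by move: three_qnr; rewrite qnrE => /andP[_ /negPf ->].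
Qed.

Lemma paley_path_system : is_path_system (@paley_adj F) (@paley_ps F).
Proof.
move=> a b ab; have ba0 : b - a != 0 by rewrite subr_eq0 eq_sym.
(* The two special cases of the definition are disjoint, so reversing a path swaps them. *)
have six : (3 : F) != - 3.
  rewrite -subr_eq0 (_ : 3 - - 3 = 2 * 3 :> F); last by ring.
  by rewrite mulf_neq0.
rewrite /paley_ps -(opprB b a) qrN // eqr_oppLR.
have [Rba|Nba] := boolP (qr (b - a)).
  by split=> //; rewrite /gpath /= paley_adjE Rba !eqxx inE (negPf ab).
have [ba3|ba3] := eqVneq (b - a) 3.
  rewrite ba3 (negPf six).
  have -> : b = a + 3 * 1 by rewrite mulr1 -ba3 addrC subrK.
  split; last by congr [:: _; _; _; _]; ring.
  by have := gpath_paley3 a _ (qr1 _); rewrite !mulr1.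
have [baN3|baN3] := eqVneq (b - a) (- 3).
  have -> : b = a + 3 * - 1 by rewrite mulrN1 -baN3 addrC subrK.
  split; last by congr [:: _; _; _; _]; ring.
  by have := gpath_paley3 a _ opp1_qr; rewrite !mulrN1.
split; last by rewrite addrC.
(* Half of a non-residue is a residue because 2 is a non-residue, so both halves are edges. *)
have half : qr ((b - a) / 2) by rewrite qnrM ?qnrV // qnrE ba0.
apply: gpath_paley2; rewrite 1?eq_sym //.
  by rewrite (_ : _ - a = (b - a) / 2) //; field.
by rewrite (_ : b - _ = (b - a) / 2) //; field.
Qed.

End PaleySystem.

(** * Non-metrizability and irreducibility *)

Section Conclusions.
Variable p : nat.
Hypotheses (p_prime : prime p) (p_gt5 : (5 < p)%N).
Hypotheses (opp1_qr : qr (-1 : 'F_p)) (two_qnr : qnr (2 : 'F_p)) (three_qnr : qnr (3 : 'F_p)).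

Let two_neq0 : (2 : 'F_p) != 0 := qnr_neq0 _ _ two_qnr.
Let three_neq0 : (3 : 'F_p) != 0 := qnr_neq0 _ _ three_qnr.

Lemma paley_not_metrizable (R : realType) :
  ~ metrizable R (@paley_adj _) (@paley_ps 'F_p).
Proof.
move=> [w [wC w_pos w_min]].
have : \sum_a w a (a + 1) <= 0.
  apply: (weight_potential p) => // [a r x Rr rh rh' Rx Ry|a].
    have a2 : a + 2 * r != a.
      by rewrite -subr_eq0 addrC addKr mulf_neq0 // qr_neq0.
    have Q : gpath (@paley_adj _) a (a + 2 * r) [:: a; a + x; a + 2 * r].
      apply: gpath_paley2 => //; first by rewrite addrC addKr.
      by rewrite opprD addrACA subrr add0r.
    rewrite eq_sym in a2; have := w_min _ _ a2 _ Q.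
    by rewrite paley_ps_midpoint //= !addr0.
  have a3 : a + 3 != a by rewrite -subr_eq0 addrC addKr.
  (* The competitor to the three-edge path has steps 9 = 3^2 and -6, the latter a residue as a
     product of two non-residues up to sign. *)
  have Q : gpath (@paley_adj _) a (a + 3) [:: a; a + 9; a + 3].
    apply: gpath_paley2 => //.
      by rewrite (_ : a + 9 - a = 3 ^+ 2) ?qr_sqr //; ring.
    rewrite (_ : a + 3 - (a + 9) = - (2 * 3)); last by ring.
    by rewrite qrN // (qnrM _ _ _ two_qnr three_qnr).
  rewrite eq_sym in a3; have := w_min _ _ a3 _ Q.
  by rewrite paley_ps_three //= !addr0 !addrA.
apply/negP; rewrite -ltNge (bigD1 0) //= ltr_pwDl ?sumr_ge0 // => [|a _].
  by apply: w_pos; rewrite paley_adjE // subr0 add0r qr1.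
by apply/ltW/w_pos; rewrite paley_adjE // addrC addKr qr1.
Qed.

(* The cut semimetric of a reduction satisfies every inequality of a metric
   realising the system, since a path of the system crosses the cut at most once. *)
Lemma paley_irreducible : irreducible_ps (@paley_ps 'F_p).
Proof.
move=> A [A0 cA0 closedA closedC].
have mid a r : qr r -> r != 3 / 2 -> r != - (3 / 2) ->
    (a \in A) = (a + 2 * r \in A) -> (a + r \in A) = (a \in A).
  move=> Rr rh rh' aA.
  have a2 : a != a + 2 * r.
    by rewrite eq_sym -subr_eq0 addrC addKr mulf_neq0 // qr_neq0.
  have [ia|ia] := boolP (a \in A); have ir := ia; rewrite aA in ir.
    have := closedA _ _ ia ir a2; rewrite paley_ps_midpoint //=.
    by case/and3P => _ /= ->.
  have := closedC a (a + 2 * r); rewrite !in_setC => /(_ ia ir a2).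
  rewrite paley_ps_midpoint //= => /and3P[_ /= + _].
  by rewrite in_setC => /negPf.
have three a : (a \in A) = (a + 3 \in A) ->
    (a + 1 \in A) = (a \in A) /\ (a + 2 \in A) = (a \in A).
  move=> aA; have a3 : a != a + 3 by rewrite eq_sym -subr_eq0 addrC addKr.
  have [ia|ia] := boolP (a \in A); have ir := ia; rewrite aA in ir.
    have := closedA _ _ ia ir a3; rewrite paley_ps_three //=.
    by case/and4P => _ /= -> ->.
  have := closedC a (a + 3); rewrite !in_setC => /(_ ia ir a3).
  rewrite paley_ps_three //= => /and4P[_ /= + + _].
  by rewrite !in_setC => /negPf -> /negPf ->.
(* Ensures that 1 differs from -3/2, so that [mid] applies with r = 1. *)
have five_neq0 : (5 : 'F_p) != 0.
  rewrite -(dvdn_pcharf (pchar_Fp p_prime)).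
  by apply/negP => /(dvdn_leq (isT : 0 < 5)%N); rewrite leqNgt p_gt5.
have one_neq_h : (1 : 'F_p) != 3 / 2.
  rewrite -subr_eq0 (_ : 1 - 3 / 2 = - 2^-1) ?oppr_eq0 ?invr_eq0 //; by field.
have one_neq_Nh : (1 : 'F_p) != - (3 / 2).
  rewrite -subr_eq0 (_ : 1 - - (3 / 2) = 5 / 2) ?mulf_neq0 ?invr_eq0 //; by field.
pose w (x y : 'F_p) : int := ((x \in A) != (y \in A))%:Z.
have : \sum_a w a (a + 1) <= 0.
  apply: (weight_potential p) => // [x y|a r x Rr rh rh' Rx Ry|a].
  - by rewrite /w eq_sym.
  - have := mid a r Rr rh rh'; rewrite /w.
    by case: (a \in A); case: (_ \in A); case: (_ \in A) => //= H;
      case: (_ \in A) => //; have := H erefl.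
  (* If [a] and [a + 3] are on the same side, the whole path is. Otherwise [mid] at r = 1 excludes
     the alternating pattern, so the path crosses once, and the detour by [a + 9] crosses too. *)
  - have := three a; have := mid a 1 (qr1 _) one_neq_h one_neq_Nh.
    have := mid (a + 1) 1 (qr1 _) one_neq_h one_neq_Nh.
    rewrite mulr1 (_ : a + 1 + 2 = a + 3); last by ring.
    rewrite (_ : a + 1 + 1 = a + 2); last by ring.
    rewrite /w; case: (a \in A); case: (a + 1 \in A); case: (a + 2 \in A);
      case: (a + 3 \in A); case: (a + 9 \in A) => // H1 H2 H3;
      by [case: (H3 erefl) | have := H1 erefl | have := H2 erefl].
have w0 a : 0 <= w a (a + 1) by rewrite /w.
(* A sum of nonnegative terms that is at most 0 has only zero terms. As 1 generates the additive
   group, [A] is then empty or everything. *)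
move=> le0; have step a : (a + 1 \in A) = (a \in A).
  have : \sum_a w a (a + 1) == 0 by rewrite eq_le le0 sumr_ge0.
  rewrite psumr_eq0 // => /allP /(_ a (mem_index_enum _)) /=.
  by rewrite /w; case: (a \in A); case: (a + 1 \in A).
have const n : (n%:R \in A) = (0 \in A).
  by elim: n => // n <-; rewrite -natr1 step.
have all_const a : (a \in A) = (0 \in A) by rewrite -(const a) natr_Zp.
have [z|z] := boolP (0 \in A).
  by case/set0Pn: cA0 => a; rewrite in_setC all_const z.
by case/set0Pn: A0 => a; rewrite all_const (negPf z).
Qed.

End Conclusions.

Theorem theorem1 (p : nat) (p_prime : prime p) (p_gt5 : (5 < p)%N)
  (hm1 : qr (-1 : 'F_p)) (h2 : qnr (2 : 'F_p)) (h3 : qnr (3 : 'F_p)) :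
  is_path_system (@paley_adj _) (@paley_ps 'F_p) /\
  irreducible_ps (@paley_ps 'F_p) /\
  (forall R : realType, ~ metrizable R (@paley_adj _) (@paley_ps 'F_p)).
Proof.
split; first exact: paley_path_system.
split; first exact: paley_irreducible.
by move=> R; exact: paley_not_metrizable.
Qed.
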